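(* Let $p\ge 3$ and $n\ge 0$ be integers, let $D$ be a $p$-angulation of an $(n+3)$-gon, and let $(m_{i,j})$ be the frieze of type $\Lambda_p$ and width $n$ corresponding to $D$. Let $v_0,\dots,v_{n+2}$ be the vertices of the associated Farey path. Then for every $0\le\alpha\le n+2$, $$v_\alpha=\frac{m_{0,\alpha-1}}{m_{1,\alpha-1}}.$$
   Context: A frieze of width $n$ is an array of real numbers $(m_{i,j})$, indexed by $i\in\mathbb{Z}$ and $j$ with $-2\le j-i\le n+1$, such that $m_{i,i-2}=m_{i,i+n+1}=0$, $m_{i,i-1}=m_{i,i+n}=1$, the remaining entries are positive, and the unimodular rule $m_{i,i+r}m_{i+1,i+r+1}-m_{i+1,i+r}m_{i,i+r+1}=1$ holds for all $i\in\mathbb{Z}$ and $-1\le r\le n$. The row $(m_{i,i})_{i\in\mathbb{Z}}$ is called the quiddity row; it determines the frieze via $m_{i,i+r}=m_{i,i}m_{i+1,i+r}-m_{i+2,i+r}$. A $p$-angulation $D$ of a convex regular polygon $P$ is a set of non-intersecting diagonals partitioning $P$ into a finite collection of $p$-gons. Let $P$ have $n+3$ vertices, labelled $0,1,\dots,n+2$ in cyclic order. Let $q_\alpha$ be the number of $p$-gons of $D$ incident with the vertex $\alpha$, and let $\lambda_p=2\cos(\pi/p)$. The frieze of type $\Lambda_p$ corresponding to $D$ is the frieze of width $n$ with $m_{i,i}=\lambda_p q_{i\bmod (n+3)}$ for all $i\in\mathbb{Z}$ (it is known that such a frieze exists and is unique). Define Möbius transformations $\xi_\alpha(z)=q_\alpha\lambda_p-\frac1z$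 for $0\le\alpha\le n+2$, acting on $\mathbb{R}\cup\{\infty\}$, and the vertices of the associated Farey path by $v_0=\infty$ and $v_\alpha=\xi_0\xi_1\cdots\xi_{\alpha-1}(\infty)$ (composition of maps) for $1\le\alpha\le n+2$. The convention $\frac10=\infty$ is used. *)

(* Defs.v *)
From HB Require Import structures.
From mathcomp Require Import all_boot all_order all_algebra.
From mathcomp Require Import reals trigo.

Set Implicit Arguments.
Unset Strict Implicit.
Unset Printing Implicit Defensive.

Import Order.TTheory GRing.Theory Num.Theory.

Local Open Scope ring_scope.

(* The vertices of a convex N-gon are the elements of 'I_N, in cyclic order.
   A polygon spanned by some of these vertices is identified with its vertex
   set S, and a segment with the pair of its endpoints. *)

(* [enum S] lists S in increasing order, so [next (enum S) a] is the vertex of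
   S that follows a in cyclic order. *)
Definition sides (N : nat) (S : {set 'I_N}) : {set {set 'I_N}} :=
  [set [set a; next (enum S) a] | a in S].

Definition diagonals (N : nat) (S : {set 'I_N}) : {set {set 'I_N}} :=
  [set e : {set 'I_N} | (e \subset S) && (#|e| == 2)] :\: sides S.

(* The two segments meet in a point interior to both; sharing an endpoint is
   not crossing. *)
Definition crossing (N : nat) (d e : {set 'I_N}) : Prop :=
  exists a b c f : 'I_N,
    [/\ (a < b < c)%N, (c < f)%N, d = [set a; c] & e = [set b; f]].

(* The polygons into which D cuts the N-gon: all their sides are sides of the
   N-gon or belong to D, and no element of D cuts them any further. *)
Definition cells (N : nat) (D : {set {set 'I_N}}) : {set {set 'I_N}} :=
  [set S : {set 'I_N} | [&& (2 < #|S|)%N,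
                            sides S \subset sides [set: 'I_N] :|: D
                          & [disjoint diagonals S & D]]].

Definition p_angulation (p N : nat) (D : {set {set 'I_N}}) : Prop :=
  [/\ D \subset diagonals [set: 'I_N],
      forall d e, d \in D -> e \in D -> ~ crossing d e
    & forall S, S \in cells D -> #|S| = p].

Definition incidence (N : nat) (D : {set {set 'I_N}}) (a : 'I_N) : nat :=
  #|[set S in cells D | a \in S]|.

(* The array is total, but only the entries m i j with -2 <= j - i <= n + 1
   are constrained. *)
Record is_frieze (R : realType) (n : nat) (m : int -> int -> R) : Prop := {
  frieze_zero_top : forall i : int, m i (i - 2) = 0;
  frieze_one_top : forall i : int, m i (i - 1) = 1;
  frieze_pos : forall i j : int, 0 <= j - i < n%:Z -> 0 < m i j;
  frieze_one_bot : forall i : int, m i (i + n%:Z) = 1;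
  frieze_zero_bot : forall i : int, m i (i + n%:Z + 1) = 0;
  frieze_unimodular : forall i r : int, -1 <= r <= n%:Z ->
    m i (i + r) * m (i + 1) (i + r + 1) - m (i + 1) (i + r) * m i (i + r + 1)
    = 1
}.

Definition lambda (R : realType) (p : nat) : R := 2 * cos (pi / p%:R).

Definition modI (n : nat) (i : int) : 'I_n.+3 := inord `|(i %% n.+3%:Z)%Z|%N.

Definition corresponding_frieze (R : realType) (p n : nat)
    (D : {set {set 'I_n.+3}}) (m : int -> int -> R) : Prop :=
  is_frieze n m /\
  forall i : int, m i i = lambda R p * (incidence D (modI n i))%:R.

(* [option R] is the real line with a point at infinity, [None]. *)
Definition infty {R : realType} : option R := None.

(* x / y with x / 0 = infty; the value infty for 0 / 0 is meaningless. *)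
Definition proj_ratio (R : realType) (x y : R) : option R :=
  if y == 0 then infty else Some (x / y).

Definition xi (R : realType) (p n : nat) (D : {set {set 'I_n.+3}})
    (a : 'I_n.+3) (z : option R) : option R :=
  match z with
  | None => Some ((incidence D a)%:R * lambda R p)
  | Some x =>
      if x == 0 then infty
      else Some ((incidence D a)%:R * lambda R p - 1 / x)
  end.

(* The iterated composition runs over b = 0, ..., a - 1 with b = 0 outermost;
   it is the identity for a = 0. *)
Definition farey_vertex (R : realType) (p n : nat) (D : {set {set 'I_n.+3}})
    (a : 'I_n.+3) : option R :=
  (\big[comp/id]_(b < n.+3 | (b < a)%N) @xi R p n D b) infty.

(* Main.v *)
Require Import Defs.
From mathcomp Require Import all_boot all_order all_algebra.
From mathcomp Require Import reals trigo.
From mathcomp Require Import ring lra zify.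

Import Order.TTheory GRing.Theory Num.Theory.
Local Open Scope ring_scope.

(** Two consecutive instances of the unimodular rule show that
    m_{i,i+k} + m_{i+2,i+k} is proportional to m_{i+1,i+k} as k varies, so the
    ratio keeps its value m_{i,i} at k = 0.  This recurrence says that xi_i
    maps m_{i+1,a-1} / m_{i+2,a-1} to m_{i,a-1} / m_{i+1,a-1}; now apply
    xi_{a-1}, ..., xi_0 in turn, starting from infinity = m_{a,a-1} / m_{a+1,a-1}. *)

(** The two extreme values of [k] land on the boundary rows of ones, all others on the positive
    entries. *)
Lemma frieze_neq0 {R : realType} {n : nat} {m : int -> int -> R} (i : int)
    (k : nat) :
  is_frieze n m -> (k <= n.+1)%N -> m (i + 1) (i + k%:Z) != 0.
Proof.
move=> fm kn; have [->|k_gt0] := posnP k.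
  have := frieze_one_top fm (i + 1); rewrite addrK addr0 => ->.
  exact: oner_neq0.
have [->|neqkn] := eqVneq k n.+1.
  have -> : i + n.+1%:Z = i + 1 + n%:Z by lia.
  by rewrite (frieze_one_bot fm) oner_neq0.
by rewrite gt_eqF // (frieze_pos fm) //; lia.
Qed.

Lemma frieze_recurrence {R : realType} {n : nat} {m : int -> int -> R}
    (i : int) (k : nat) :
  is_frieze n m -> (k <= n.+1)%N ->
  m i (i + k%:Z) = m i i * m (i + 1) (i + k%:Z) - m (i + 2) (i + k%:Z).
Proof.
move=> fm; elim: k => [_|k IHk ltkn].
  have := frieze_one_top fm (i + 1); have := frieze_zero_top fm (i + 2).
  by rewrite !addrK addr0 => -> ->; rewrite mulr1 subr0.
have unim0 : m i (i + k%:Z) * m (i + 1) (i + k.+1%:Z)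
    - m (i + 1) (i + k%:Z) * m i (i + k.+1%:Z) = 1.
  have := frieze_unimodular fm i (r := k%:Z).
  have -> : i + k%:Z + 1 = i + k.+1%:Z by lia.
  by apply; lia.
have unim1 : m (i + 1) (i + k%:Z) * m (i + 2) (i + k.+1%:Z)
    - m (i + 2) (i + k%:Z) * m (i + 1) (i + k.+1%:Z) = 1.
  (* For [k = 0] this is [r = -1], the lowest index the rule allows. *)
  have := frieze_unimodular fm (i + 1) (r := k%:Z - 1).
  have -> : i + 1 + (k%:Z - 1) = i + k%:Z by lia.
  have -> : i + k%:Z + 1 = i + k.+1%:Z by lia.
  have -> : i + 1 + 1 = i + 2 by lia.
  by apply; lia.
have lekn : (k <= n.+1)%N by lia.
(* After multiplication by the nonzero entry m_{i+1,i+k}, the claim is the difference of [unim0] and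
   [unim1]. *)
apply: (mulfI (frieze_neq0 i k fm lekn)).
rewrite (IHk lekn) in unim0; lra.
Qed.

(** This is the action of the matrix with rows (q lambda, -1) and (1, 0) on homogeneous coordinates;
    [x != 0] rules out the meaningless 0 / 0. *)
Lemma xi_proj_ratio {R : realType} {p n : nat} {D : {set {set 'I_n.+3}}}
    (b : 'I_n.+3) (x y : R) :
  x != 0 ->
  xi p D b (proj_ratio x y) =
  proj_ratio ((incidence D b)%:R * lambda R p * x - y) x.
Proof.
move=> x0; rewrite /proj_ratio (negPf x0); have [->|y0] := eqVneq y 0 => /=.
  by rewrite subr0 mulfK.
rewrite mulf_eq0 invr_eq0 (negPf x0) (negPf y0) /=.
by congr Some; field; rewrite x0.
Qed.

Lemma modI_nat (n k : nat) : (k < n.+3)%N -> modI n k%:Z = inord k.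
Proof. by move=> ltkn; rewrite /modI modz_nat /= modn_small. Qed.

(** The start [i] is left free because the induction on length peels off the outermost map, so the
    remaining composition starts at [i + 1]. *)
Lemma xi_comp_infty {R : realType} {p n : nat} {D : {set {set 'I_n.+3}}}
    {m : int -> int -> R} (i k : nat) :
  corresponding_frieze p D m -> (i + k <= n.+2)%N ->
  (\big[comp/id]_(i <= b < i + k) @xi R p n D (inord b)) infty =
  proj_ratio (m i%:Z (i%:Z + k%:Z - 1)) (m (i%:Z + 1) (i%:Z + k%:Z - 1)).
Proof.
move=> [fm mii]; elim: k i => [|k IHk] i leikn.
  rewrite addn0 big_geq // addr0 (frieze_one_top fm).
  have -> : i%:Z - 1 = i%:Z + 1 - 2 by lia.
  by rewrite (frieze_zero_top fm) /proj_ratio eqxx.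
have lek : (k <= n.+1)%N by lia.
rewrite big_ltn; last by lia.
rewrite -addSnnS /= IHk; last by lia.
have -> : i.+1%:Z + k%:Z - 1 = i%:Z + k%:Z by lia.
have -> : i%:Z + k.+1%:Z - 1 = i%:Z + k%:Z by lia.
have -> : i.+1%:Z = i%:Z + 1 by lia.
have -> : i%:Z + 1 + 1 = i%:Z + 2 by lia.
rewrite xi_proj_ratio; last exact: (frieze_neq0 i%:Z k fm).
rewrite [m i%:Z _](frieze_recurrence i%:Z k fm lek) mii modI_nat; last by lia.
by rewrite [lambda R p * _]mulrC.
Qed.

Theorem lemma17 (R : realType) (p n : nat) (hp : (3 <= p)%N)
    (D : {set {set 'I_n.+3}}) (hD : p_angulation p D)
    (m : int -> int -> R) (hm : corresponding_frieze p D m)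
    (a : 'I_n.+3) :
  farey_vertex R p D a = proj_ratio (m 0 (a%:Z - 1)) (m 1 (a%:Z - 1)).
Proof.
have lean : (0 + a <= n.+2)%N by exact: (ltn_ord a).
have := xi_comp_infty 0 a hm lean.
rewrite !add0r add0n big_mkord => <-; rewrite /farey_vertex.
(* Indices below [a] become indices below [n + 3] filtered by [b < a], as in [farey_vertex]. *)
rewrite (big_ord_widen n.+3 (fun b => @xi R p n D (inord b)) (ltnW (ltn_ord a))).
by under [in RHS]eq_bigr do rewrite inord_val.
Qed.
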